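(* For every $\boldsymbol{B}$-algebra $S$, the topological space $\operatorname{CSpec}(S)$ (with the Zariski topology) is quasi-compact.
   Context: A semiring is a commutative semiring $(S,+,\cdot)$ with additive identity $0_S$ (absorbing for multiplication) and multiplicative identity $1_S$. $\boldsymbol{B}=\{0,-\infty\}$ is the Boolean semifield with operations $\max$ (addition) and $+$ (multiplication). A semiring $S$ is a $\boldsymbol{B}$-algebra (i.e. receives a semiring homomorphism from $\boldsymbol{B}$) if and only if it is additively idempotent: $a+a=a$ for all $a\in S$. A congruence on $S$ is an equivalence relation $C\subset S\times S$ such that $(a,b),(c,d)\in C$ implies $(a+c,b+d)\in C$ and $(a\cdot c,b\cdot d)\in C$; it is proper if $C\neq S\times S$. A congruence $C$ is prime if it is proper and $(a\cdot c+b\cdot d,\ a\cdot d+b\cdot c)\in C$ implies $(a,b)\in C$ or $(c,d)\in C$. $\operatorname{CSpec}(S)$ is the set of prime congruences on $S$ with the Zariski topology, whose closed sets are $V(C)=\{P\in\operatorname{CSpec}(S)\mid C\subset P\}$ for $C$ a congruence on $S$. Quasi-compact means that every open cover has a finite subcover. *)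

(* Defs.v *)
From HB Require Import structures.
From mathcomp Require Import all_boot all_algebra.
From mathcomp Require Import boolp classical_sets topology.

Set Implicit Arguments.
Unset Strict Implicit.
Unset Printing Implicit Defensive.

Import GRing.Theory.

Local Open Scope classical_set_scope.
Local Open Scope ring_scope.

(* The two elements 0 and -oo of the tropical numbers.  Beware that the
   additive identity of the semiring is -oo ([B_ninf]) and the multiplicative
   identity is the number 0 ([B_zero]).  The type [bool] itself cannot be used:
   its ring structure in the library is that of the field with two elements. *)
Inductive boolean_semifield : Set := B_zero | B_ninf.

Definition B_max (x y : boolean_semifield) : boolean_semifield :=
  if x is B_zero then B_zero else y.

Definition B_plus (x y : boolean_semifield) : boolean_semifield :=
  if x is B_zero then y else B_ninf.

Definition B_to_bool (x : boolean_semifield) : bool :=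
  if x is B_zero then true else false.

Definition B_of_bool (b : bool) : boolean_semifield :=
  if b then B_zero else B_ninf.

Lemma B_to_boolK : cancel B_to_bool B_of_bool.
Proof. by case. Qed.

HB.instance Definition _ :=
  Countable.copy boolean_semifield (can_type B_to_boolK).

Fact B_maxA : associative B_max. Proof. by do 3!case. Qed.
Fact B_maxC : commutative B_max. Proof. by do 2!case. Qed.
Fact B_max0 : left_id B_ninf B_max. Proof. by case. Qed.
Fact B_plusA : associative B_plus. Proof. by do 3!case. Qed.
Fact B_plusC : commutative B_plus. Proof. by do 2!case. Qed.
Fact B_plus1 : left_id B_zero B_plus. Proof. by case. Qed.
Fact B_plus_maxl : left_distributive B_plus B_max. Proof. by do 3!case. Qed.
Fact B_plus0 : left_zero B_ninf B_plus. Proof. by case. Qed.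
Fact B_oner_neq0 : B_zero != B_ninf. Proof. by []. Qed.

HB.instance Definition _ :=
  GRing.isNmodule.Build boolean_semifield B_maxA B_maxC B_max0.
HB.instance Definition _ :=
  GRing.Nmodule_isComNzSemiRing.Build boolean_semifield
    B_plusA B_plusC B_plus1 B_plus_maxl B_plus0 B_oner_neq0.

Section Congruences.
Variable S : comPzSemiRingType.
Implicit Types C D : set (S * S).

Record congruence C : Prop := Congruence {
  congr_refl : forall a, C (a, a);
  congr_sym : forall a b, C (a, b) -> C (b, a);
  congr_trans : forall a b c, C (a, b) -> C (b, c) -> C (a, c);
  congrD : forall a b c d, C (a, b) -> C (c, d) -> C (a + c, b + d);
  congrM : forall a b c d, C (a, b) -> C (c, d) -> C (a * c, b * d)
}.

Record prime_congruence C : Prop := PrimeCongruence {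
  prime_congr : congruence C;
  prime_proper : C <> setT;
  primeP : forall a b c d,
    C (a * c + b * d, a * d + b * c) -> C (a, b) \/ C (c, d)
}.

Definition congr_gen (X : set (S * S)) : set (S * S) :=
  [set p | forall C, congruence C -> X `<=` C -> C p].

Lemma congr_genP X : congruence (congr_gen X).
Proof.
split=> [a C cC _|a b h C cC XC|a b c h k C cC XC|a b c d h k C cC XC
  |a b c d h k C cC XC].
- exact: congr_refl.
- by apply: (congr_sym cC); exact: h.
- by apply: (congr_trans cC); [exact: h | exact: k].
- by apply: (congrD cC); [exact: h | exact: k].
- by apply: (congrM cC); [exact: h | exact: k].
Qed.

Lemma sub_congr_gen X : X `<=` congr_gen X.
Proof. by move=> p Xp C _; apply. Qed.

Lemma congr_gen_sub X C : congruence C -> (congr_gen X `<=` C) = (X `<=` C).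
Proof.
move=> cC; apply/propext; split=> [h|XC p]; last by apply.
exact: subset_trans (@sub_congr_gen X) h.
Qed.

End Congruences.

Record CSpec (S : comPzSemiRingType) : Type := CSpecPoint {
  cspec_congr :> set (S * S);
  cspecP : prime_congruence cspec_congr
}.

HB.instance Definition _ (S : comPzSemiRingType) := gen_eqMixin (CSpec S).
HB.instance Definition _ (S : comPzSemiRingType) := gen_choiceMixin (CSpec S).

Section Zariski.
Variable S : comPzSemiRingType.

Definition zariski_V (C : set (S * S)) : set (CSpec S) :=
  [set P : CSpec S | C `<=` P].

Definition zariski_open (U : set (CSpec S)) : Prop :=
  exists2 C, congruence C & ~` U = zariski_V C.

Fact zariski_openT : zariski_open setT.
Proof.
exists setT; first by split.
rewrite setCT; apply/seteqP; split=> // P; rewrite /zariski_V /= => TP.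
case: (prime_proper (cspecP P)).
by apply/seteqP; split.
Qed.

Fact zariski_openI : setI_closed zariski_open.
Proof.
move=> U W [C cC UC] [D cD WD].
pose X : set (S * S) := [set p | exists a b c d, [/\ C (a, b), D (c, d)
  & p = (a * c + b * d, a * d + b * c)]].
exists (congr_gen X); first exact: congr_genP.
rewrite setCI UC WD; apply/seteqP; split=> P; rewrite /zariski_V /=.
all: have cP := prime_congr (cspecP P).
- rewrite congr_gen_sub // => h p [a [b [c [d [Cab Dcd ->]]]]].
  case: h => h.
    rewrite [a * d + _]addrC; apply: (congrD cP); apply: (congrM cP).
    + exact: h.
    + exact: congr_refl.
    + by apply: (congr_sym cP); apply: h.
    + exact: congr_refl.
  apply: (congrD cP); apply: (congrM cP).
  + exact: congr_refl.
  + exact: h.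
  + exact: congr_refl.
  + by apply: (congr_sym cP); apply: h.
- rewrite congr_gen_sub // => XP.
  have [CP|/existsNP[[a b]]] := pselect (C `<=` P); first by left.
  move=> /not_implyP[Cab nPab]; right=> -[c d] Dcd.
  have /(primeP (cspecP P))[//|//] : cspec_congr P (a * c + b * d, a * d + b * c).
  by apply: XP; exists a, b, c, d.
Qed.

Fact zariski_open_bigU (I : Type) (f : I -> set (CSpec S)) :
  (forall i, zariski_open (f i)) -> zariski_open (\bigcup_i f i).
Proof.
move=> fo; pose X : set (S * S) := [set p | exists i C, [/\ congruence C,
  ~` f i = zariski_V C & C p]].
exists (congr_gen X); first exact: congr_genP.
rewrite setC_bigcup; apply/seteqP; split=> P; rewrite /zariski_V /=.
all: rewrite congr_gen_sub; last exact: prime_congr (cspecP P).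
- move=> h p [i [C [_ fC Cp]]].
  have : (~` f i) P by exact: h.
  by rewrite fC; apply.
- move=> XP i _; have [C cC fC] := fo i.
  rewrite fC => p Cp; apply: XP; by exists i, C.
Qed.

HB.instance Definition _ := isOpenTopological.Build (CSpec S)
  zariski_openT zariski_openI zariski_open_bigU.

Lemma closed_CSpecP (F : set (CSpec S)) :
  closed F <-> exists2 C, congruence C & F = zariski_V C.
Proof.
rewrite -openC; split=> -[C cC e]; exists C => //; first by rewrite -e setCK.
by rewrite setCK.
Qed.

End Zariski.

(* Main.v *)
Require Import Defs.
From mathcomp Require Import all_boot all_algebra.
From mathcomp Require Import boolp classical_sets topology.
From mathcomp Require finmap.

(** In an additively idempotent semiring a congruence lies below some prime
    congruence as soon as it does not identify [0] and [1]
    ([exists_prime_congruence]).  Granting this, a cover of the spectrum by the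
    complements of the [V(C_i)] has a finite subcover: the join of the [C_i]
    lies below no prime congruence, hence identifies [0] and [1]; congruence
    generation is finitary ([congruence_finite_joins]), so the join of finitely
    many [C_i] already does; and a congruence identifying [0] and [1] is
    improper.

    The prime congruence is produced as the kernel of a homomorphism to the
    Boolean semifield.  Modulo [C], addition is the join of a partial order in
    which multiplication is monotone.  The elements sent to the zero of the
    Boolean semifield must form an ideal that is downward closed and prime.
    Zorn's lemma yields a downward closed ideal maximal among those avoiding
    [1].  It is prime by the usual argument: if [a] and [b] are outside, then
    [1] is below some [i + s a] and below some [j + t b], hence below their
    product, which is in the ideal as soon as [a b] is
    ([exists_prime_lower_ideal]). *)

Section IdempotentSemiring.
Import GRing.Theory.
Local Open Scope classical_set_scope.
Local Open Scope ring_scope.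

Variable S : comPzSemiRingType.
Hypothesis addxx : forall x : S, x + x = x.
Variable C : set (S * S).
Hypothesis cC : congruence C.

(** * The order modulo a congruence *)

Definition le_mod (a b : S) : Prop := C (a + b, b).

Lemma le_mod_refl a : le_mod a a.
Proof. by rewrite /le_mod addxx; exact: congr_refl. Qed.

Lemma le_mod_addr a b : le_mod a (a + b).
Proof. by rewrite /le_mod addrA addxx; exact: congr_refl. Qed.

Lemma congr_le_mod a b : C (a, b) -> le_mod a b.
Proof.
by move=> ab; rewrite /le_mod -{2}[b]addxx; apply: congrD => //;
  exact: congr_refl.
Qed.

Lemma le_mod_trans b a c : le_mod a b -> le_mod b c -> le_mod a c.
Proof.
move=> ab bc.
apply: (@congr_trans _ _ cC _ (a + (b + c))).
  apply: congrD => //; first exact: congr_refl.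
  exact: congr_sym.
rewrite addrA; apply: (@congr_trans _ _ cC _ (b + c)) => //.
by apply: congrD => //; exact: congr_refl.
Qed.

Lemma le_modD a b c d : le_mod a b -> le_mod c d -> le_mod (a + c) (b + d).
Proof. by move=> ab cd; rewrite /le_mod addrACA; exact: congrD. Qed.

Lemma le_modM a b c d : le_mod a b -> le_mod c d -> le_mod (a * c) (b * d).
Proof.
move=> ab cd.
have e : C ((a + b) * (c + d), b * d) by exact: congrM.
(* [(a + b) * (c + d)] represents the class of [b * d] and, once expanded, has
   [a * c] as a summand. *)
apply: (@congr_trans _ _ cC _ (a * c + (a + b) * (c + d))).
  apply: congrD => //; first exact: congr_refl.
  exact: congr_sym.
suff -> : a * c + (a + b) * (c + d) = (a + b) * (c + d) by [].
by rewrite mulrDl mulrDr !addrA addxx.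
Qed.

(** * Downward closed ideals *)

(** Membership of [0] is left out, so that the empty set qualifies: Zorn's
    lemma for unions of chains includes the empty chain.  A nonempty such set
    contains [0] anyway. *)
Record lower_ideal (I : set S) : Prop := LowerIdeal {
  lower_idealW : forall a b, le_mod a b -> I b -> I a;
  lower_idealD : forall a b, I a -> I b -> I (a + b);
  lower_idealM : forall r a, I a -> I (r * a)
}.

Definition lower_closure (K : set S) : set S :=
  [set x | exists2 k, K k & le_mod x k].

Lemma sub_lower_closure K : K `<=` lower_closure K.
Proof. by move=> x Kx; exists x => //; exact: le_mod_refl. Qed.

Lemma lower_closure_ideal (K : set S) :
  (forall a b, K a -> K b -> K (a + b)) -> (forall r a, K a -> K (r * a)) ->
  lower_ideal (lower_closure K).
Proof.
move=> KD KM; split=> [a b ab [k Kk bk]|a b [k Kk ak] [l Kl bl]|r a [k Kk ak]].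
- by exists k => //; exact: le_mod_trans bk.
- by exists (k + l); [exact: KD | exact: le_modD].
- by exists (r * k); [exact: KM | exact: le_modM (le_mod_refl r) ak].
Qed.

Lemma bigcup_chain_lower_ideal (F : set (set S)) :
  (forall I, F I -> lower_ideal I) -> total_on F subset ->
  lower_ideal (\bigcup_(I in F) I).
Proof.
move=> FI Ftot; split=> [a b ab [I FIi Ib]|a b [I FIi Ia] [J FJ Jb]
  |r a [I FIi Ia]].
- by exists I => //; exact: lower_idealW (FI I FIi) _ _ ab Ib.
- have [IJ|JI] := Ftot I J FIi FJ.
  + by exists J => //; apply: lower_idealD (FI J FJ) _ _ _ Jb; exact: IJ.
  + by exists I => //; apply: lower_idealD (FI I FIi) _ _ Ia _; exact: JI.
- by exists I => //; exact: lower_idealM (FI I FIi) _ _ Ia.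
Qed.

Definition adjoin (I : set S) (a : S) : set S :=
  lower_closure [set x | exists i s, I i /\ x = i + s * a].

Lemma adjoin_ideal I a : lower_ideal I -> lower_ideal (adjoin I a).
Proof.
move=> iI; apply: lower_closure_ideal.
- move=> _ _ [i [s [Ii ->]]] [j [t [Ij ->]]]; exists (i + j), (s + t).
  by split; [exact: lower_idealD | rewrite addrACA mulrDl].
- move=> r _ [i [s [Ii ->]]]; exists (r * i), (r * s).
  by split; [exact: lower_idealM | rewrite mulrDr mulrA].
Qed.

Lemma sub_adjoin I a : I `<=` adjoin I a.
Proof.
move=> i Ii; apply: sub_lower_closure; exists i, 0.
by rewrite mul0r addr0.
Qed.

Lemma mem_adjoin (I : set S) a : I 0 -> adjoin I a a.
Proof.
by move=> I0; apply: sub_lower_closure; exists 0, 1; rewrite mul1r add0r.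
Qed.

(** Since [1] is its own square and multiplication is monotone, [1] is below the
    product of the two bounds, and every term of the expanded product is a
    multiple of an element of [I] or of [a * b]. *)
Lemma adjoin1M I a b : lower_ideal I -> I (a * b) ->
  adjoin I a 1 -> adjoin I b 1 -> I 1.
Proof.
move=> iI Iab [_ [i [s [Ii ->]]] le1a] [_ [j [t [Ij ->]]] le1b].
have := le_modM _ _ _ _ le1a le1b; rewrite mulr1 => /(lower_idealW _ iI); apply.
rewrite mulrDl; apply: (lower_idealD _ iI).
  by rewrite mulrC; exact: lower_idealM.
rewrite mulrDr; apply: (lower_idealD _ iI); first exact: lower_idealM.
by rewrite mulrACA; exact: lower_idealM.
Qed.

(** * Primes from downward closed ideals *)

Hypothesis C01 : ~ C (0, 1).

Lemma exists_prime_lower_ideal : exists I : set S,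
  [/\ lower_ideal I, I 0, ~ I 1 & forall a b, I (a * b) -> I a \/ I b].
Proof.
pose proper_ideal I := lower_ideal I /\ ~ I 1.
have [F FP Ftot|M [[iM M1] Mmax]] := @Zorn_bigcup S proper_ideal.
  split; first by apply: bigcup_chain_lower_ideal => // I /FP[].
  by move=> [I /FP[_]].
have Mmax1 J a : lower_ideal J -> M `<=` J -> J a -> ~ M a -> J 1.
  move=> iJ MJ Ja Ma; apply: contrapT => J1.
  by apply: (Mmax J) => //; split=> // JM; exact/Ma/JM.
have M0 : M 0.
  apply: contrapT => nM0.
  (* Without [0], [M] is empty, hence not maximal: the class of [0] is a larger
     downward closed ideal, proper since [0] and [1] are not congruent. *)
  have zero_ideal : lower_ideal (lower_closure [set 0]).
    apply: lower_closure_ideal => [_ _ -> ->|r _ ->] /=; first exact: addr0.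
    exact: mulr0.
  have [||k -> ] := Mmax1 _ 0 zero_ideal _ _ nM0.
  - by move=> a /(lower_idealM _ iM 0); rewrite mul0r.
  - exact: sub_lower_closure.
  - by rewrite /le_mod addr0 => /(congr_sym cC).
exists M; split=> // a b Mab.
apply: contrapT => /not_orP[nMa nMb]; apply: M1.
by apply: (adjoin1M _ _ _ iM Mab);
  [apply: (Mmax1 _ a) | apply: (Mmax1 _ b)] => //;
  solve [exact: adjoin_ideal | exact: sub_adjoin | exact: mem_adjoin].
Qed.

(** Primality of equality in the Boolean semifield, read on truth values: the
    propositions stand for being sent to the zero. *)
Lemma boolean_primeP (a b c d : Prop) :
  ((a \/ c) /\ (b \/ d) <-> (a \/ d) /\ (b \/ c)) -> (a <-> b) \/ (c <-> d).
Proof.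
have [ha|na] := EM a; have [hb|nb] := EM b => -[lr rl]; first by left.
- right; split=> [hc|hd].
  + by have [_ []] := rl (conj (or_introl ha) (or_intror hc)).
  + by have [_ []] := lr (conj (or_introl ha) (or_intror hd)).
- right; split=> [hc|hd].
  + by have [[]] := lr (conj (or_intror hc) (or_introl hb)).
  + by have [[]] := rl (conj (or_intror hd) (or_introl hb)).
- by left.
Qed.

(** The two classes of the congruence are a prime downward closed ideal and its
    complement, so the quotient is the Boolean semifield. *)
Lemma exists_prime_congruence :
  exists P : CSpec S, C `<=` cspec_congr P.
Proof.
have [I [iI I0 I1 Iprime]] := exists_prime_lower_ideal.
have ID a b : I (a + b) <-> I a /\ I b.
  split=> [Iab|[]]; last exact: lower_idealD.
  by split; apply: (lower_idealW _ iI _ _ _ Iab);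
    [|rewrite addrC]; exact: le_mod_addr.
have IM a b : I (a * b) <-> I a \/ I b.
  split=> [/Iprime //|[Ia|Ib]]; last exact: lower_idealM.
  by rewrite mulrC; exact: lower_idealM.
pose P : set (S * S) := [set p | I p.1 <-> I p.2].
have cP : congruence P.
  split=> [a|a b|a b c|a b c d|a b c d]; rewrite /P /=; rewrite ?ID ?IM; tauto.
have pP : prime_congruence P.
  split=> // [PT|a b c d].
    by have : P (0, 1); [rewrite PT | move=> /= -[/(_ I0)]].
  rewrite /P /= !ID !IM.
  exact: boolean_primeP.
exists (CSpecPoint pP) => -[a b] Cab /=.
by split; apply: (lower_idealW _ iI); apply: congr_le_mod => //;
  exact: congr_sym.
Qed.

End IdempotentSemiring.

(** * Finite joins of congruences and compactness *)

Section FiniteJoins.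
Import finmap.
Local Open Scope classical_set_scope.
Local Open Scope fset_scope.

Variables (S : comPzSemiRingType) (I : choiceType).
Variables (D : set I) (E : I -> set (S * S)).

Definition finite_join (A : {fset I}) : set (S * S) :=
  congr_gen (\bigcup_(i in [set` A]) E i).

Lemma finite_join_mono (A B : {fset I}) :
  A `<=` B -> (finite_join A `<=` finite_join B)%classic.
Proof.
move=> /fsubsetP AB p Ap G cG BG; apply: Ap => // q [i /= /AB iB Eq].
by apply: BG; exists i.
Qed.

Definition finite_joins : set (S * S) :=
  [set p | exists2 A : {fset I}, {subset A <= D} & finite_join A p].

(** The directed union of the finite joins is the join of the whole family, so
    membership in the latter is witnessed by finitely many members. *)
Lemma congruence_finite_joins : congruence finite_joins.
Proof.
have joins2 p q r :
    (forall G : set (S * S), congruence G -> G p -> G q -> G r) ->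
    finite_joins p -> finite_joins q -> finite_joins r.
  move=> pqr [A AD Ap] [B BD Bq]; exists (A `|` B).
    by move=> i /fsetUP[/AD|/BD].
  apply: pqr; first exact: congr_genP.
  - exact: finite_join_mono (fsubsetUl _ _) _ Ap.
  - exact: finite_join_mono (fsubsetUr _ _) _ Bq.
split=> [a|a b ab|a b c|a b c d|a b c d].
- by exists fset0 => //; exact: congr_refl (congr_genP _) _.
- by apply: (joins2 _ _ _ _ ab ab) => G cG _; exact: congr_sym.
- by apply: joins2 => G cG; exact: congr_trans.
- by apply: joins2 => G cG; exact: congrD.
- by apply: joins2 => G cG; exact: congrM.
Qed.

Lemma sub_finite_joins i : D i -> (E i `<=` finite_joins)%classic.
Proof.
move=> Di p Ep; exists [fset i]; first by move=> j /fset1P ->; exact/mem_set.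
by apply: sub_congr_gen; exists i => //=; exact/fset1P.
Qed.

End FiniteJoins.

(** Multiplying the pair [(0, 1)] by [x] identifies every [x] with [0]. *)
Lemma congruence01 (S : comPzSemiRingType) (C : set (S * S)) :
  congruence C -> C (0, 1)%R -> C = setT.
Proof.
move=> cC C01; apply/seteqP; split=> // -[a b] _.
have C0 x : C (0, x)%R.
  by have := congrM cC (congr_refl cC x) C01; rewrite GRing.mulr0 GRing.mulr1.
exact: congr_trans cC _ _ _ (congr_sym cC (C0 a)) (C0 b).
Qed.

Theorem corollary3p3 (S : comPzSemiRingType)
    (phi : {rmorphism boolean_semifield -> S}) :
  cover_compact [set: CSpec S]%classic.
Proof.
have addxx (x : S) : (x + x = x)%R.
  have e : (1 + 1 = 1 :> S)%R by rewrite -(GRing.rmorph1 phi) -GRing.rmorphD.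
  by rewrite -{1 2}[x]GRing.mulr1 -GRing.mulrDr e GRing.mulr1.
move=> I D f fopen Dcover.
have /choice[E fE] : forall i, exists C : set (S * S),
    D i -> (~` f i = zariski_V C)%classic.
  move=> i; have [Di|nDi] := pselect (D i); last by exists setT.
  by have [C _ fC] := fopen i Di; exists C.
have [[A AD A01]|n01] := pselect (finite_joins S I D E (0, 1)%R).
- exists A => // P _; apply: contrapT => nfP.
  apply: (prime_proper (cspecP P)).
  have cP := prime_congr (cspecP P); apply: congruence01 => //.
  apply: A01 => // p [i /= iA Ep].
  have Di : D i by apply/set_mem/AD.
  have : (~` f i)%classic P by move=> fiP; apply: nfP; exists i.
  by rewrite (fE i Di); apply.
- have cE := congruence_finite_joins S I D E.
  have [P EP] := exists_prime_congruence S addxx _ cE n01.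
  have [i Di fiP] := Dcover P Logic.I.
  have : zariski_V (E i) P.
    by move=> p Ep; apply: EP; exact: sub_finite_joins Ep.
  by rewrite -(fE i Di); case.
Qed.
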